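(* Let $n\ge 1$ and let $\Delta=(\Delta_{ij})$ be an integer $n\times n$ matrix such that $\det\Delta\neq 0$, $\Delta_{ij}\le 0$ for all $i\ne j$, and there exists a vector $\mathbf r\in\mathbb Z^n$ with $\mathbf r>0$ and $\mathbf r\Delta\ge 0$. Let $\mathbf r\in\mathscr R(\Delta)$. For any integer vector $\mathbf v=(v_1,\dots,v_n)$, there exists a $(\Delta,\mathbf r)$-recurrent configuration $\mathbf u$ such that $\mathbf v-\mathbf u\in\langle\Delta\rangle$.
   Context: Vectors are row vectors. $\mathbf r>0$ means $r_i>0$ for all $i$; $\mathbf r\ge \mathbf r'$ means $r_i\ge r'_i$ for all $i$. $\mathscr R(\Delta)=\{\mathbf r\in\mathbb Z^n : \mathbf r>0,\ \mathbf r\Delta\ge 0\}$. $\Delta_i$ is the $i$-th row of $\Delta$, and $\langle\Delta\rangle=\mathbb Z\Delta_1\oplus\cdots\oplus\mathbb Z\Delta_n$ is the sublattice of $\mathbb Z^n$ spanned by the rows of $\Delta$. A configuration is a row vector $\mathbf u\in\mathbb Z^n$ with $u_i\ge 0$ for all $i$. A vertex $i\in\{1,\dots,n\}$ is critical for $\mathbf u$ if $u_i\ge\Delta_{ii}$; $\mathbf u$ is stable if no vertex is critical, i.e. $0\le u_i<\Delta_{ii}$ for all $i$. Toppling a critical vertex $i$ replaces $\mathbf u$ by $\mathbf u-\Delta_i$. A sequence of topplings from $\mathbf u$ is a sequence $i_1,\dots,i_k$ such that $i_j$ is critical for $\mathbf u-\Delta_{i_1}-\cdots-\Delta_{i_{j-1}}$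 for each $1\le j\le k$; it transforms $\mathbf u$ into $\mathbf u-\sum_{j=1}^k\Delta_{i_j}$. A $(\Delta,\mathbf r)$-recurrent configuration is a stable configuration $\mathbf u$ such that $\mathbf u+\mathbf r\Delta$ can be transformed into $\mathbf u$ by a sequence of topplings. *)

(* Defs.v *)
From mathcomp Require Import all_boot all_order all_algebra.

Set Implicit Arguments.
Unset Strict Implicit.
Unset Printing Implicit Defensive.

Import Order.TTheory GRing.Theory Num.Theory.

Local Open Scope ring_scope.

Definition rv_pos n (r : 'rV[int]_n) : Prop := forall i, 0 < r 0 i.

Definition rv_ge n (r r' : 'rV[int]_n) : Prop := forall i, r' 0 i <= r 0 i.

Definition in_scrR n (Delta : 'M[int]_n) (r : 'rV[int]_n) : Prop :=
  rv_pos r /\ rv_ge (r *m Delta) 0.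

Definition in_row_lattice n (Delta : 'M[int]_n) (w : 'rV[int]_n) : Prop :=
  inIntSpan [tuple row i Delta | i < n] w.

Definition configuration n (u : 'rV[int]_n) : Prop := forall i, 0 <= u 0 i.

Definition critical n (Delta : 'M[int]_n) (u : 'rV[int]_n) (i : 'I_n) : Prop :=
  Delta i i <= u 0 i.

Definition stable n (Delta : 'M[int]_n) (u : 'rV[int]_n) : Prop :=
  configuration u /\ forall i, ~ critical Delta u i.

Definition topple n (Delta : 'M[int]_n) (u : 'rV[int]_n) (i : 'I_n) :
  'rV[int]_n := u - row i Delta.

Fixpoint toppling_seq n (Delta : 'M[int]_n) (u : 'rV[int]_n) (s : seq 'I_n) :
  Prop :=
  if s is i :: s' then
    critical Delta u i /\ toppling_seq Delta (topple Delta u i) s'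
  else True.

(* Nonnegativity of the intermediate vectors is not required explicitly: it
   follows from that of u when the off-diagonal entries of Delta are <= 0. *)
Definition transforms_into n (Delta : 'M[int]_n) (u w : 'rV[int]_n) : Prop :=
  exists s : seq 'I_n,
    toppling_seq Delta u s /\ w = u - \sum_(i <- s) row i Delta.

Definition recurrent n (Delta : 'M[int]_n) (r u : 'rV[int]_n) : Prop :=
  stable Delta u /\ transforms_into Delta (u + r *m Delta) u.

(* Main.v *)
(** The proof is a least action argument. If [w - m Delta] is subcritical for
    some [m >= 0], then any vertex critical for [w] occurs in [m], so legal
    topplings of [w] only consume [m]: they stop after at most [sum m] steps.
    Inverse positivity of [Delta] (minimum principle against [r]) thus yields a
    stable configuration in the class of [v]. For a stable [u], apply the
    principle to [u + r Delta] with [m = r]: the result is [u + m' Delta] with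
    [m' >= 0]. Either [m' = 0] and [u] is recurrent, or one restarts from
    [u + m' Delta]; this stops because stable configurations are bounded and
    [det Delta <> 0]. *)
Require Import Defs.
From mathcomp Require Import all_boot all_order all_algebra.
From mathcomp Require Import zify ring.

Set Implicit Arguments.
Unset Strict Implicit.
Unset Printing Implicit Defensive.

Import Order.TTheory GRing.Theory Num.Theory.

Local Open Scope ring_scope.

Section Sandpile.

Variables (n : nat) (Delta : 'M[int]_n).
Hypothesis Delta_offdiag : forall i j : 'I_n, i != j -> Delta i j <= 0.

(** Since [m 0 i = 0], only off-diagonal entries of column [i] contribute. Both the minimum
    principle and the least action principle rest on this sign. *)
Lemma mulmx_offdiag_le0 (m : 'rV[int]_n) (i : 'I_n) :
  rv_ge m 0 -> m 0 i = 0 -> (m *m Delta) 0 i <= 0.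
Proof.
move=> m_ge0 mi0; rewrite mxE; apply: sumr_le0 => j _.
have [->|neq_ji] := eqVneq j i; first by rewrite mi0 mul0r.
by apply: mulr_ge0_le0; [have := m_ge0 j; rewrite mxE | exact: Delta_offdiag].
Qed.

(** Let [i] minimize [x_j / r_j]. Then [y = r_i x - x_i r] is nonnegative and vanishes at [i], so
    [(y Delta)_i <= 0]; but [x_i < 0] would make [r_i (x Delta)_i - x_i (r Delta)_i] positive. *)
Lemma inverse_positive (r x : 'rV[int]_n) :
    rv_pos r -> rv_ge (r *m Delta) 0 -> rv_pos (x *m Delta) ->
  rv_ge x 0.
Proof.
move=> r_gt0 rD_ge0 xD_gt0 k; rewrite mxE.
pose ratio j : rat := (x 0 j)%:~R / (r 0 j)%:~R.
have [i _ min_i] := @arg_minP _ _ _ k predT ratio isT.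
(* Clearing the positive denominators brings the minimality back to integers. *)
have xr j : x 0 i * r 0 j <= x 0 j * r 0 i.
  have := min_i j isT.
  rewrite /ratio ler_pdivrMr ?ltr0z // mulrAC ler_pdivlMr ?ltr0z //.
  by rewrite -!intrM ler_int.
have ri := r_gt0 i; have rk := r_gt0 k.
suff xi : 0 <= x 0 i.
  by rewrite -(pmulr_lge0 _ ri) (le_trans _ (xr k)) // mulr_ge0 // ltW.
rewrite leNgt; apply/negP => xi_lt0.
have y_ge0 : rv_ge (r 0 i *: x - x 0 i *: r) 0.
  by move=> j; rewrite !mxE subr_ge0 [leRHS]mulrC.
have yi0 : (r 0 i *: x - x 0 i *: r) 0 i = 0 by rewrite !mxE mulrC subrr.
have := mulmx_offdiag_le0 y_ge0 yi0; rewrite mulmxBl -!scalemxAl.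
move: (rD_ge0 i) (xD_gt0 i); move: (r *m Delta) (x *m Delta) => rD xD.
rewrite !mxE => rD_i xD_i; apply/negP; rewrite -ltNge subr_gt0.
by apply: (@le_lt_trans _ _ 0); rewrite ?mulr_gt0 ?mulr_le0_ge0 // ltW.
Qed.

(** Here [m'] is the part of [m] left over when the topplings stop. *)
Lemma least_action (w m : 'rV[int]_n) :
    configuration w -> rv_ge m 0 ->
    (forall i, (w - m *m Delta) 0 i < Delta i i) ->
  exists s : seq 'I_n, exists2 m' : 'rV[int]_n, rv_ge m' 0 &
    [/\ toppling_seq Delta w s,
        w - \sum_(i <- s) row i Delta = w - (m - m') *m Delta &
        stable Delta (w - (m - m') *m Delta)].
Proof.
have [N] := ubnP `|(\sum_i m 0 i)%R|%N.
elim: N w m => // N IH w m; rewrite ltnS => le_mN w_ge0 m_ge0 m_sub.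
have [/existsP[i crit_i]|/existsPn stab_w] :=
    boolP [exists i, Delta i i <= w 0 i]; last first.
  exists [::], m => //; rewrite big_nil subrr mul0mx subr0; split=> //.
  by split=> // i; apply/negP; exact: stab_w.
(* If [m 0 i] were zero, subtracting [m Delta] could not lower entry [i], which would stay
   critical. *)
have mi_gt0 : 0 < m 0 i.
  have := m_ge0 i; rewrite mxE le_eqVlt => /predU1P[mi0|//].
  have := mulmx_offdiag_le0 m_ge0 (esym mi0); have := m_sub i.
  by move: (m *m Delta) => mD; rewrite !mxE; move: crit_i => /=; lia.
have mB : (m - delta_mx 0 i) *m Delta = m *m Delta - row i Delta.
  by rewrite mulmxBl rowE.
have [| | | |s [m' m'_ge0 [top_s sum_s stab_s]]] :=
    IH (topple Delta w i) (m - delta_mx 0 i).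
- have -> : \sum_j (m - delta_mx 0 i) 0 j = \sum_j m 0 j - 1.
    under eq_bigr do rewrite !mxE /=.
    rewrite big_split sumrN; congr (_ - _).
    by rewrite (bigD1 i) //= eqxx big1 ?addr0 // => j /negPf->.
  have : 1 <= \sum_j m 0 j.
    rewrite (bigD1 i) //= -[1]addr0 lerD -?gtz0_ge1 // sumr_ge0 // => j _.
    by have := m_ge0 j; rewrite mxE.
  by move: le_mN; lia.
- move=> j; rewrite !mxE; have [->|neq_ji] := eqVneq j i; first by rewrite subr_ge0.
  by move: neq_ji (w_ge0 j); rewrite eq_sym => /Delta_offdiag; move=> /=; lia.
- move=> j; have := m_ge0 j; rewrite !mxE /=.
  by have [->|_] := eqVneq j i; move: mi_gt0; lia.
- by move=> j; rewrite mB /topple opprB addrA subrK; exact: m_sub.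
have wE : topple Delta w i - (m - delta_mx 0 i - m') *m Delta
          = w - (m - m') *m Delta.
  rewrite mulmxBl mB mulmxBl /topple.
  move: (m *m Delta) (m' *m Delta) => mD m'D; apply/rowP => j.
  by rewrite !mxE /=; ring.
exists (i :: s), m' => //; split=> //; last by rewrite -wE.
by rewrite big_cons opprD addrA -wE.
Qed.

Lemma in_row_lattice_mulmx (m : 'rV[int]_n) : in_row_lattice Delta (m *m Delta).
Proof.
exists [ffun i => m 0 i]; rewrite mulmx_sum_row; apply: eq_bigr => i _.
by rewrite ffunE -scaler_int intz (nth_mktuple (fun j => row j Delta) 0 i).
Qed.

Hypothesis det_neq0 : \det Delta != 0.

Lemma exists_stable (r v : 'rV[int]_n) : in_scrR Delta r ->
  exists m, stable Delta (v + m *m Delta).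
Proof.
case=> r_gt0 rD_ge0.
(* Integral substitute for [1 Delta^-1]: every entry of [x Delta] is [(det Delta)^2 >= 1], whatever
   the sign of the determinant. *)
pose x := \det Delta *: (const_mx 1 *m \adj Delta) : 'rV[int]_n.
have xD i : 1 <= (x *m Delta) 0 i.
  rewrite /x -scalemxAl -mulmxA mul_adj_mx mul_mx_scalar !mxE.
  by rewrite mulr1 -expr2 -gtz0_ge1 exprn_even_gt0.
have x_ge0 : rv_ge x 0.
  by apply: inverse_positive r_gt0 rD_ge0 _ => i; exact: lt_le_trans (xD i).
have bound (F : 'I_n -> int) i : `|F i| <= \sum_j `|F j|.
  by rewrite (bigD1 i) //= lerDl sumr_ge0.
(* As [x Delta >= 1] entrywise, adding [A] copies of it makes [v] nonnegative, and removing [B]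
   copies from [w] makes it subcritical; the [+ 1] in [B] gives strictness. *)
pose A := \sum_j `|v 0 j|.
pose w := v + A *: x *m Delta.
pose B := \sum_j `|w 0 j - Delta j j| + 1.
have [| | |s [m' _ [_ _ stab]]] := @least_action w (B *: x).
- move=> i; have := bound (v 0) i; rewrite -/A /w -scalemxAl.
  by move: (x *m Delta) (xD i) => xD'; rewrite !mxE /=; nia.
- move=> i; have := x_ge0 i; rewrite !mxE => xi_ge0.
  by rewrite mulr_ge0 // addr_ge0 // sumr_ge0.
- move=> i; have := bound (fun j => w 0 j - Delta j j) i; rewrite /B -scalemxAl /=.
  move: (\sum_j _) (x *m Delta) (xD i) => S xD'.
  by clearbody w; rewrite !mxE /=; nia.
exists (A *: x - (B *: x - m')).
by move: stab; rewrite /w -addrA -mulmxBl.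
Qed.

(** Stability bounds each entry of [m Delta], and pairing with [c], for which [Delta c] is
    constantly [det Delta], recovers [det Delta] times the sum of [m]. *)
Lemma stable_coord_bounded (v : 'rV[int]_n) :
  exists C : int, forall m, stable Delta (v + m *m Delta) -> \sum_i m 0 i <= C.
Proof.
pose c := \adj Delta *m const_mx 1 : 'cV[int]_n.
exists (\sum_i (`|Delta i i| + `|v 0 i|) * `|c i 0|) => m [u_ge0 u_stab].
have mE : (\sum_i m 0 i) * \det Delta = \sum_i (m *m Delta) 0 i * c i 0.
  transitivity ((m *m Delta *m c) 0 0); last by rewrite mxE.
  rewrite /c mulmxA -(mulmxA m) mul_mx_adj mul_mx_scalar mxE mulr_suml.
  by apply: eq_bigr => i _; rewrite !mxE mulr1 mulrC.
apply: (@le_trans _ _ `|(\sum_i m 0 i) * \det Delta|).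
  by rewrite normrM (le_trans (ler_norm _)) // ler_peMr // -gtz0_ge1 normr_gt0.
rewrite mE; apply: le_trans (ler_norm_sum _ _ _) _; apply: ler_sum => i _.
rewrite normrM ler_wpM2r //.
have /negP := u_stab i; have := u_ge0 i; rewrite mxE /=; lia.
Qed.

Lemma exists_recurrent (r v : 'rV[int]_n) : in_scrR Delta r ->
  exists m, recurrent Delta r (v + m *m Delta).
Proof.
move=> hr; have [C m_le_C] := stable_coord_bounded v.
have [m stab_m] := exists_stable v hr.
(* This gap is nonnegative at every stable representative, and each restart shrinks it by the sum of
   [m']. *)
have [N] := ubnP `|(C - \sum_i m 0 i)%R|%N.
elim: N m stab_m => // N IH m stab_m lt_N.
set u := v + m *m Delta in stab_m *.
have [u_ge0 u_stab] := stab_m.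
have [r_gt0 rD_ge0] := hr.
have [| | |s [m' m'_ge0 [top_s sum_s stab_s]]] := @least_action (u + r *m Delta) r.
- by move=> i; rewrite mxE addr_ge0 //; have := rD_ge0 i; rewrite [(0 : 'rV_n) 0 i]mxE.
- by move=> i; rewrite mxE ltW.
- by move=> i; rewrite addrK ltNge; apply/negP; exact: u_stab.
have uE : u + r *m Delta - (r - m') *m Delta = u + m' *m Delta.
  by rewrite mulmxBl opprB addrA addrAC addrK.
(* If nothing is left of [r], the topplings remove exactly [r Delta] and return to [u]. *)
have [m'0|m'_neq0] := eqVneq m' 0.
  exists m; split=> //; exists s; split=> //.
  by rewrite sum_s uE m'0 mul0mx addr0.
have stab_mm' : stable Delta (v + (m + m') *m Delta).
  by rewrite mulmxDl addrA -uE.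
have sum_gt0 : 0 < \sum_i m' 0 i.
  have m'i_ge0 i : true -> 0 <= m' 0 i by have := m'_ge0 i; rewrite mxE.
  rewrite lt_neqAle sumr_ge0 // andbT eq_sym psumr_neq0 //.
  apply: contraNT m'_neq0; rewrite -all_predC => /allP all0.
  apply/eqP/rowP => i; rewrite mxE; apply/eqP.
  by have := all0 i (mem_index_enum i); rewrite /= -leNgt eq_le m'i_ge0 // andbT.
have sumD : \sum_i (m + m') 0 i = \sum_i m 0 i + \sum_i m' 0 i.
  by rewrite -big_split; apply: eq_bigr => i _; rewrite mxE.
apply: (IH _ stab_mm'); have := m_le_C _ stab_mm'; rewrite sumD.
by move: (\sum_i m 0 i) (\sum_i m' 0 i) lt_N sum_gt0 => S S'; lia.
Qed.

End Sandpile.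

Theorem lemma3p6 (n : nat) (hn : (1 <= n)%N) (Delta : 'M[int]_n)
    (hdet : \det Delta != 0)
    (hoff : forall i j : 'I_n, i != j -> Delta i j <= 0)
    (hex : exists r0 : 'rV[int]_n, rv_pos r0 /\ rv_ge (r0 *m Delta) 0)
    (r : 'rV[int]_n) (hr : in_scrR Delta r) (v : 'rV[int]_n) :
  exists u : 'rV[int]_n,
    recurrent Delta r u /\ in_row_lattice Delta (v - u).
Proof.
have [m rec_m] := exists_recurrent hoff hdet v hr.
exists (v + m *m Delta); split=> //.
have -> : v - (v + m *m Delta) = - m *m Delta.
  by rewrite opprD addNKr mulNmx.
exact: in_row_lattice_mulmx.
Qed.
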